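(* Let $d\ge 14$ and $k\in\mathbb{N}$. In the ordered chain game on the $d$-dimensional $k$-wedge $W^d_k$, Walker has a strategy to build a chain of size $k$ (i.e., a chain containing an element of every level $0,1,\dots,k-1$).
   Context: The $d$-dimensional $k$-wedge $W^d_k$ is the poset of nonnegative integer $d$-tuples with coordinate sum less than $k$, ordered coordinatewise ($x\preceq y$ iff $x_i\le y_i$ for all $i$); level $\ell$ is the set of tuples with coordinate sum $\ell$. In the ordered chain game (Walker-Blocker game) on a finite poset, Walker and Blocker alternately (Walker first) choose previously unchosen elements until all are chosen. Walker builds a chain of size $m$ if there are elements $x_1\prec x_2\prec\cdots\prec x_m$ all chosen by Walker, chosen in this order in time (the chain is built from bottom to top). *)

(* Defs.v *)
From HB Require Import structures.
From mathcomp Require Import all_boot all_order.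

Set Implicit Arguments.
Unset Strict Implicit.
Unset Printing Implicit Defensive.

Import Order.TTheory.

Section Game.
Context {T : finType}.

(* A history or play is the sequence of all chosen elements, in order of time;
   Walker moves first, so her choices are those at even positions. *)
Definition walker_moves (p : seq T) : seq T :=
  mask (mkseq (fun i => ~~ odd i) (size p)) p.

(* Strategies are option-valued only so that they exist on the empty poset. *)
Definition walker_strategy (s : seq T -> option T) : Prop :=
  forall h : seq T, uniq h -> ~~ odd (size h) -> size h < #|T| ->
  exists2 x, s h = Some x & x \notin h.

Definition complete_play (p : seq T) : Prop := uniq p /\ forall x, x \in p.

Definition follows (s : seq T -> option T) (p : seq T) : Prop :=
  forall h x t, p = h ++ x :: t -> ~~ odd (size h) -> s h = Some x.

Definition walker_can_force (goal : seq T -> Prop) : Prop :=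
  exists2 s, walker_strategy s &
  forall p, complete_play p -> follows s p -> goal p.

End Game.

(* [subseq] records that the chain is chosen from bottom to top in time. *)
Definition walker_builds disp (T : finPOrderType disp) (p c : seq T) : Prop :=
  sorted <%O c /\ subseq c (walker_moves p).

Section Wedge.
Variables d k : nat.

(* Bounding the coordinates by k loses nothing (see [wedge_surj]) and makes
   the type finite; [tupleprod] carries the coordinatewise order. *)
Definition wedge_pred (x : d.-tupleprod 'I_k) : bool :=
  \sum_(i < d) (tnth x i : nat) < k.

Record wedge := Wedge {wedge_val :> d.-tupleprod 'I_k; _ : wedge_pred wedge_val}.

HB.instance Definition _ := [isSub for wedge_val].
HB.instance Definition _ := [Finite of wedge by <:].
HB.instance Definition _ :=
  [SubChoice_isSubPOrder of wedge by <: with (Order.Disp tt tt)].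

Definition coord (x : wedge) (i : 'I_d) : nat := tnth (val x) i.

Definition level (x : wedge) : nat := \sum_(i < d) coord x i.

Lemma wedge_le (x y : wedge) :
  (x <= y)%O = [forall i, coord x i <= coord y i].
Proof. by rewrite leEsub leEtprod; apply: eq_forallb => i; rewrite leEord. Qed.

Lemma coord_inj (x y : wedge) : coord x =1 coord y -> x = y.
Proof. by move=> e; apply/val_inj/eq_from_tnth => i; apply/val_inj/e. Qed.

Lemma level_lt (x : wedge) : level x < k.
Proof. exact: (valP x). Qed.

Lemma wedge_surj (f : 'I_d -> nat) :
  \sum_(i < d) f i < k -> exists x : wedge, coord x =1 f.
Proof.
move=> fk; have fltk i : f i < k.
  by apply: leq_ltn_trans fk; rewrite (bigD1 i) //= leq_addr.
pose x : d.-tupleprod 'I_k := [tuple Ordinal (fltk i) | i < d].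
have xP : wedge_pred x.
  by rewrite /wedge_pred; under eq_bigr do rewrite tnth_mktuple.
by exists (Sub x xP) => i; rewrite /coord SubK tnth_mktuple.
Qed.

End Wedge.

(* Main.v *)
Require Import Defs.
From HB Require Import structures.
From mathcomp Require Import all_boot all_order ssralg ssrnum ssrint zify.
From Stdlib Require Import Classical ClassicalEpsilon.

(* Kloster's strategy for the angel problem, on the triangular lattice.  Moves in
   14 coordinates project to moves between lattice triangles, and from each
   triangle one can reach all 12 triangles that share a vertex with it: 6
   coordinates act as translations, while each of the 8 others sends upward
   triangles to downward ones and back; six vectors are needed in each direction,
   and with a suitable offset the two sets of six share four.

   Walker keeps a set X of triangles and follows its boundary with X on her left;
   she stands on the triangle to the right of the current edge.  After each move of
   Blocker she enlarges X, away from the triangles visited, so as to minimise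
   [boundary length] + [blocked triangles outside X], taking X largest among the
   minimisers.  Adding a triangle that touches X along an edge lengthens the
   boundary by at most 1, so an unvisited triangle on her way is never blocked.
   Except for an immediate sharp turn, which costs no move, the walk never returns
   to a visited triangle: if it closed up, adding the pocket that it encloses would
   save as many edges as Blocker has had moves since the loop began, and so would
   already have paid off then. *)

Set Implicit Arguments.
Unset Strict Implicit.
Unset Printing Implicit Defensive.

Import Order.TTheory GRing.Theory Num.Theory.

Local Open Scope ring_scope.

(** * Directed edges and triangles of the triangular lattice *)

Inductive dir := East | NEast | NWest | West | SWest | SEast.

Definition dir_code (h : dir) : nat :=
  match h with
  | East => 0 | NEast => 1 | NWest => 2 | West => 3 | SWest => 4 | SEast => 5
  end.

Lemma dir_code_inj : injective dir_code.
Proof. by do 2!case. Qed.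

HB.instance Definition _ := Equality.copy dir (inj_type dir_code_inj).

Lemma dirE (h h' : dir) : (h == h') = (dir_code h == dir_code h').
Proof. by []. Qed.

Definition dirs := [:: East; NEast; NWest; West; SWest; SEast].

Lemma mem_dirs h : h \in dirs.
Proof. by case: h. Qed.

Definition ccw h :=
  match h with
  | East => NEast | NEast => NWest | NWest => West
  | West => SWest | SWest => SEast | SEast => East
  end.

Definition cw h :=
  match h with
  | East => SEast | NEast => East | NWest => NEast
  | West => NWest | SWest => West | SEast => SWest
  end.

Definition back h := ccw (ccw (ccw h)).

Notation vertex := (int * int)%type.
Notation dart := (vertex * dir)%type.
Notation cell := (vertex * bool)%type.

Definition shift (v : vertex) (h : dir) : vertex :=
  match h with
  | East => (v.1 + 1, v.2) | NEast => (v.1, v.2 + 1)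
  | NWest => (v.1 - 1, v.2 + 1) | West => (v.1 - 1, v.2)
  | SWest => (v.1, v.2 - 1) | SEast => (v.1 + 1, v.2 - 1)
  end.

(* The triangle at [v] between the directions [h] and [ccw h].  The upward triangle
   [(a, b, false)] has vertices (a, b), (a+1, b), (a, b+1); the downward one
   [(a, b, true)] has (a+1, b), (a+1, b+1), (a, b+1). *)
Definition sector (v : vertex) (h : dir) : cell :=
  match h with
  | East => (v.1, v.2, false) | NEast => (v.1 - 1, v.2, true)
  | NWest => (v.1 - 1, v.2, false) | West => (v.1 - 1, v.2 - 1, true)
  | SWest => (v.1, v.2 - 1, false) | SEast => (v.1, v.2 - 1, true)
  end.

Definition dart0 : dart := (0, 0, East).
Definition source (x : dart) : vertex := x.1.
Definition target (x : dart) : vertex := shift x.1 x.2.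
Definition rev_dart (x : dart) : dart := (target x, back x.2).
Definition left (x : dart) : cell := sector x.1 x.2.
Definition right (x : dart) : cell := sector x.1 (cw x.2).

Ltac coords := rewrite /= ?xpair_eqE ?dirE /=; lia.

Lemma left_rev x : left (rev_dart x) = right x.
Proof. by case: x => [[a b] []]; apply/eqP; rewrite /left /right /=; coords. Qed.

Lemma right_rev x : right (rev_dart x) = left x.
Proof. by case: x => [[a b] []]; apply/eqP; rewrite /left /right /=; coords. Qed.

Definition turn (x : dart) : dart := (target x, ccw (ccw x.2)).

(** [turn] cycles through the three sides of the triangle on the left. *)
Lemma left_eq x y : left x = left y ->
  [\/ x = y, x = turn y | x = turn (turn y)].
Proof.
case: x y => [[a b] h] [[a' b'] h'] /eqP.
by case: h; case: h' => //=; rewrite /left /turn /target /= ?xpair_eqE /= => ?;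
  (try by (constructor 1; apply/eqP; coords));
  (try by (constructor 2; apply/eqP; coords));
  (try by (constructor 3; apply/eqP; coords)); lia.
Qed.

Lemma right_eq x y : right x = right y ->
  [\/ source x = source y, source x = target y | target x = source y].
Proof.
case: x y => [[a b] h] [[a' b'] h'] /eqP.
by case: h; case: h' => //=; rewrite /right /source /target /= ?xpair_eqE /= => ?;
  (try by (constructor 1; apply/eqP; coords));
  (try by (constructor 2; apply/eqP; coords));
  (try by (constructor 3; apply/eqP; coords)); lia.
Qed.

(** * Winding numbers of closed walks around triangles *)

(* Signed crossing of the ray that runs east from [c]. *)
Definition cross (x : dart) (c : cell) : int :=
  match x.2 with
  | NEast => ((x.1.2 == c.1.2) && (c.1.1 < x.1.1) : bool)%:Z
  | NWest => ((x.1.2 == c.1.2) && (c.1.1 + (c.2 : nat)%:Z < x.1.1) : bool)%:Z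
  | SWest => - ((x.1.2 - 1 == c.1.2) && (c.1.1 < x.1.1) : bool)%:Z
  | SEast => - ((x.1.2 - 1 == c.1.2) &&
                (c.1.1 + (c.2 : nat)%:Z < x.1.1 + 1) : bool)%:Z
  | _ => 0
  end.

Definition wind (L : seq dart) (c : cell) : int := \sum_(x <- L) cross x c.

(* Corrects the effect of changing rows in [cross_diff]; it cancels along closed
   walks. *)
Definition pot (y : dart) (v : vertex) : int :=
  match y.2 with
  | East => - ((v.2 == y.1.2) && (y.1.1 < v.1) : bool)%:Z
  | West => ((v.2 == y.1.2) && (y.1.1 - 1 < v.1) : bool)%:Z
  | _ => 0
  end.

(** Moving the origin of the ray across [y] changes the crossing with [x] only if [x] runs along
    that edge, up to a term that depends on the endpoints of [x]. *)
Lemma cross_diff (y x : dart) :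
  cross x (left y) - cross x (right y) =
  (x == y : bool)%:Z - (x == rev_dart y : bool)%:Z
  + (pot y (target x) - pot y (source x)).
Proof.
case: y x => [[a b] h] [[a' b'] h'].
case: h; case: h'; rewrite /cross /pot /left /right /target /source /=.
all: by rewrite !xpair_eqE !dirE /=; lia.
Qed.

Definition linked : rel dart := fun x y => target x == source y.

Lemma walk_sum (phi : vertex -> int) x s : path linked x s ->
  \sum_(y <- x :: s) (phi (target y) - phi (source y)) =
  phi (target (last x s)) - phi (source x).
Proof.
elim: s x => [|y s IHs] x /=; first by rewrite big_seq1.
by case/andP=> /eqP xy /IHs; rewrite big_cons => ->; rewrite xy addrC subrKA.
Qed.

Lemma sum_count (y : dart) L :
  \sum_(x <- L) (x == y : bool)%:Z = (count_mem y L)%:Z.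
Proof.
elim: L => [|x L IHL]; first by rewrite big_nil.
by rewrite big_cons IHL /= PoszD.
Qed.

Lemma wind_diff L y : cycle linked L ->
  wind L (left y) - wind L (right y) =
  (count_mem y L)%:Z - (count_mem (rev_dart y) L)%:Z.
Proof.
move=> cL; rewrite /wind -sumrB (eq_bigr _ (fun x _ => cross_diff y x)) big_split /=.
have -> : \sum_(x <- L) (pot y (target x) - pot y (source x)) = 0.
  case: L cL => [|x s] /=; first by rewrite big_nil.
  rewrite rcons_path => /andP[xs /eqP e].
  by rewrite (walk_sum _ xs) e subrr.
by rewrite addr0 sumrB !sum_count.
Qed.

Lemma wind_row L c : (forall x, x \in L -> c.1.2 + 1 < x.1.2 \/ x.1.2 < c.1.2) ->
  wind L c = 0.
Proof.
case: c => [[p q] t] far; rewrite /wind big_seq big1 // => x /far.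
by case: x => [[a b] h]; rewrite /cross /=; case: h => //= ?; lia.
Qed.

(** * Following the boundary of a set of triangles *)

Definition sub (X Y : pred cell) : Prop := forall c, X c -> Y c.

(* Connectedness of [c] and [c'] in [X] through edges, in the only form needed:
   for functions such as winding numbers. *)
Definition joined (X : pred cell) (c c' : cell) : Prop :=
  forall w : cell -> int,
    (forall y, X (left y) -> X (right y) -> w (left y) = w (right y)) ->
  w c = w c'.

Lemma joined_trans X c1 c2 c3 : joined X c1 c2 -> joined X c2 c3 -> joined X c1 c3.
Proof. by move=> h1 h2 w Xw; rewrite (h1 w Xw); apply: h2. Qed.

Lemma joined_sub X Y c c' : sub X Y -> joined X c c' -> joined Y c c'.
Proof. by move=> XY h w Yw; apply: h => y /XY ly /XY ry; apply: Yw. Qed.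

Lemma joined_sector (X : pred cell) v h :
  X (sector v h) -> X (sector v (cw h)) -> joined X (sector v (cw h)) (sector v h).
Proof. by move=> lX rX w Xw; rewrite -(Xw (v, h)). Qed.

(* The leftmost turn at the target of [x]; any other boundary edge there could belong
   to a different component of [X]. *)
Definition next (X : pred cell) (x : dart) : dart :=
  let v := target x in let h := x.2 in
  if ~~ X (sector v (ccw h)) then (v, ccw (ccw h)) else
  if ~~ X (sector v h) then (v, ccw h) else
  if ~~ X (sector v (cw h)) then (v, h) else
  if ~~ X (sector v (cw (cw h))) then (v, cw h) else (v, cw (cw h)).

Lemma left_sector x : left x = sector (target x) (ccw (ccw x.2)).
Proof. by case: x => [[a b] []]; apply/eqP; rewrite /left /target /=; coords. Qed.

Lemma right_sector x : right x = sector (target x) (back x.2).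
Proof. by case: x => [[a b] []]; apply/eqP; rewrite /right /target /=; coords. Qed.

Lemma ccwK : cancel ccw cw. Proof. by case. Qed.
Lemma cw3 h : cw (cw (cw h)) = back h. Proof. by case: h. Qed.

Lemma source_next X x : source (next X x) = target x.
Proof. by rewrite /next; do 4!case: ifP => _ //. Qed.

(** Rotate clockwise about the target, starting from [left x]: the triangles passed before the first
    one outside [X] form a chain in [X] joined to [left x]. The rotation stops at [right x] at the
    latest; this last case is the sharp turn. *)
Lemma next_boundary (X : pred cell) x : X (left x) -> ~~ X (right x) ->
  [/\ X (left (next X x)), ~~ X (right (next X x))
    & joined X (left (next X x)) (left x)].
Proof.
rewrite left_sector right_sector /next => l r.
set v := target x; set h := x.2; rewrite -/v -/h in l r *.
have st k : X (sector v k) -> X (sector v (cw k)) ->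
    joined X (sector v k) (sector v (ccw (ccw h))) ->
    joined X (sector v (cw k)) (sector v (ccw (ccw h))).
  by move=> k1 k2; apply/joined_trans/joined_sector.
have j0 : joined X (sector v (ccw (ccw h))) (sector v (ccw (ccw h))) by [].
case: ifPn => [|/negPn] c1; first by rewrite /left /right /= ccwK.
have := st _ l; rewrite ccwK => /(_ c1 j0) j1.
case: ifPn => [|/negPn] c2; first by rewrite /left /right /= ccwK.
have := st _ c1; rewrite ccwK => /(_ c2 j1) j2.
case: ifPn => [|/negPn] c3; first by rewrite /left /right /=.
have j3 := st _ c2 c3 j2.
case: ifPn => [|/negPn] c4; first by rewrite /left /right /=.
by have j4 := st _ c3 c4 j3; rewrite /left /right /= cw3.
Qed.

(** * Boundary length, blocked triangles and optimal sets *)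

Section Cost.
Variable R : nat.

Definition range : seq int := [seq i%:Z - R%:Z | i <- iota 0 R.*2.+1].

Definition box : seq dart :=
  [seq (v, h) | v <- [seq (a, b) | a <- range, b <- range], h <- dirs].

Lemma mem_range (a : int) : (a \in range) = (`|a| <= R%:Z).
Proof.
apply/mapP/idP => [[i]|aR]; first by rewrite mem_iota => ? ->; lia.
by exists (absz (a + R%:Z)); rewrite ?mem_iota; lia.
Qed.

Lemma uniq_range : uniq range.
Proof. by rewrite map_inj_uniq ?iota_uniq // => i j /= /addIr []. Qed.

Lemma mem_box x : (x \in box) = (`|x.1.1| <= R%:Z) && (`|x.1.2| <= R%:Z).
Proof.
case: x => [[a b] h]; rewrite -!mem_range.
apply/allpairsP/andP => [[[v h'] [vr _ [ev _]]]|[ha hb]].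
  by move: vr; rewrite -ev => /allpairsP [[p q] [hp hq [-> ->]]].
exists (a, b, h); split; rewrite ?mem_dirs //.
by apply/allpairsP; exists (a, b).
Qed.

Lemma uniq_box : uniq box.
Proof.
apply: allpairs_uniq => [||[? ?] [? ?] _ _ /= [-> ->]] //.
by apply: allpairs_uniq => [||[? ?] [? ?] _ _ /= [-> ->]] //; apply: uniq_range.
Qed.

Definition boundary (X : pred cell) : seq dart :=
  [seq x <- box | X (left x) && ~~ X (right x)].

Definition missed (X : pred cell) (D : seq cell) : nat := count (predC X) D.

Definition cost (D : seq cell) (X : pred cell) : nat :=
  size (boundary X) + missed X D.

Lemma uniq_boundary X : uniq (boundary X).
Proof. exact/filter_uniq/uniq_box. Qed.

Lemma mem_boundary X x :
  (x \in boundary X) = [&& X (left x), ~~ X (right x) & x \in box].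
Proof. by rewrite mem_filter -andbA. Qed.

Lemma missed_sub X Y D : sub X Y -> (missed Y D <= missed X D)%N.
Proof. by move=> XY; apply: sub_count => c; apply: contra; apply: XY. Qed.

Lemma cost_cons X b D : (cost (b :: D) X <= (cost D X).+1)%N.
Proof. by rewrite /cost /missed /=; case: (X b) => /=; lia. Qed.

Lemma cost_cons_ge X b D : (cost D X <= cost (b :: D) X)%N.
Proof. by rewrite /cost /missed /=; lia. Qed.

(** The floor at height [- R] excludes the whole plane, whose boundary is empty. *)
Definition avoids (E : seq dart) (X : pred cell) : Prop :=
  (forall x, x \in E -> ~~ X (right x)) /\ (forall c, c.1.2 <= - R%:Z -> ~~ X c).

(** Only growth seen from a dart of [box] counts, since this is what the tie-break [void] in
    [optimum] detects. *)
Definition exceeds (X Y : pred cell) : Prop :=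
  sub X Y /\ exists x, [/\ x \in box, Y (right x) & ~~ X (right x)].

Lemma min_ex (A : Type) (P : A -> Prop) (m : A -> nat) a : P a ->
  exists2 b, P b & forall c, P c -> (m b <= m c)%N.
Proof.
have [n] := ubnP (m a); elim: n a => // n IHn a ma Pa.
have [[c [Pc cm]]|no] := classic (exists c, P c /\ (m c < m a)%N).
  by apply: (IHn c) => //; apply: leq_trans cm _.
by exists a => // c Pc; rewrite leqNgt; apply/negP => cm; apply: no; exists c.
Qed.

Lemma optimum E D X : avoids E X ->
  exists Y, [/\ sub X Y, avoids E Y, (cost D Y <= cost D X)%N &
    forall Z, avoids E Z -> exceeds Y Z -> (cost D Y < cost D Z)%N].
Proof.
move=> XE; pose void (Z : pred cell) := count (fun x => ~~ Z (right x)) box.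
(* [N] exceeds every value of [void], so the weighted sum minimised next orders sets by cost first
   and by size within the box second. *)
pose N := (size box).+1.
have [|Y [XY YE] minY] := @min_ex _ (fun Z => sub X Z /\ avoids E Z)
  (fun Z => cost D Z * N + void Z)%N X; first by split.
have voidN Z : (void Z < N)%N by rewrite ltnS count_size.
exists Y; split=> // [|Z ZE [YZ [x [xb Zx Yx]]]].
  have /minY : sub X X /\ avoids E X by split.
  move: (voidN X) (voidN Y); rewrite -/N; nia.
have /minY : sub X Z /\ avoids E Z by split=> // c /XY/YZ.
suff : (void Z < void Y)%N by nia.
rewrite /void -!size_filter.
apply: (@leq_trans (size (x :: [seq y <- box | ~~ Z (right y)]))) => //.
apply: uniq_leq_size.
  by rewrite cons_uniq mem_filter Zx filter_uniq ?uniq_box.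
move=> y; rewrite inE !mem_filter => /predU1P[->|/andP[Zy ->]]; first by rewrite Yx.
by rewrite andbT; apply: contra Zy; apply: YZ.
Qed.

(** Winding numbers around [L] vanish on the left of [L] and [E], and are negative on the right of
    [L]. Adding all triangles of negative winding number therefore removes the edges of [L] from the
    boundary; it creates no new edge, because the winding number jumps only across [L]. *)
Lemma pocket X D E L M :
  cycle linked L -> L != [::] -> uniq M -> {subset M <= L} ->
  avoids [::] X ->
  (forall x, x \in L -> [/\ X (left x), ~~ X (right x)
    & `|x.1.1| + 1 < R%:Z /\ `|x.1.2| + 1 < R%:Z]) ->
  (forall x, x \in L ++ E -> joined X (left x) (0, R%:Z, false)) ->
  (forall x, x \in E -> [/\ X (left x), ~~ X (right x) & x \notin L]) ->
  exists Y, [/\ avoids E Y, exceeds X Y & (cost D Y + size M <= cost D X)%N].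
Proof.
move=> cL L0 uM ML [_ Xlow] LX LEj EL.
have nL y : X (right y) -> y \notin L by apply: contraL => /LX[].
have w_in y : X (left y) -> X (right y) -> wind L (left y) = wind L (right y).
  move=> yl yr; apply/eqP; rewrite -subr_eq0 wind_diff //.
  by rewrite !(count_memPn _) ?subrr ?nL ?right_rev.
have w_row c : (R%:Z <= c.1.2) || (c.1.2 <= - R%:Z) -> wind L c = 0.
  by case: c => [[p q] t] /= hc; apply: wind_row => -[[a b] h] /LX [_ _ [_ /=]]; lia.
(* The triangle [(0, R%:Z, false)] lies above all of [L], and winding numbers are constant along
   connections in [X]. *)
have w0 y : y \in L ++ E -> wind L (left y) = 0.
  by move=> /LEj ->; rewrite // w_row // lexx.
have w_le y : X (left y) -> wind L (right y) <= wind L (left y).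
  move=> yl; rewrite -subr_ge0 wind_diff //.
  by rewrite (count_memPn (nL (rev_dart y) _)) ?right_rev //; lia.
have w_right y : y \in L ++ E -> X (left y) ->
    wind L (right y) = - (count_mem y L)%:Z.
  move=> yLE yl; have := wind_diff y cL; rewrite w0 //.
  rewrite (count_memPn (nL (rev_dart y) _)) ?right_rev //; lia.
pose Y c := X c || (wind L c < 0).
have w_out y : Y (left y) -> ~~ Y (right y) ->
    [/\ X (left y), ~~ X (right y) & y \notin L].
  rewrite /Y !negb_or -leNgt => yl /andP[yr w].
  have rl : rev_dart y \notin L by apply/negP => /LX[]; rewrite left_rev (negPf yr).
  have := wind_diff y cL; rewrite (count_memPn rl) => e.
  have xl : X (left y) by case/orP: yl => //; lia.
  split=> //; apply/negP => yL.
  have := w_right y; rewrite mem_cat yL => /(_ isT xl).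
  by move: yL; rewrite -has_pred1 has_count; lia.
have XY : sub X Y by move=> c Xc; rewrite /Y Xc.
exists Y; split.
- split=> [x xE|c cR]; rewrite /Y negb_or -leNgt.
    have [xl -> xL] := EL x xE.
    by rewrite w_right ?mem_cat ?xE ?orbT // (count_memPn xL) lexx.
  by rewrite Xlow // w_row ?cR ?orbT.
- split=> //; have /hasP [x xL _] : has predT L by rewrite has_predT lt0n size_eq0.
  have [xl xr xR] := LX x xL; exists x; split=> //; first by rewrite mem_box; lia.
  by rewrite /Y w_right ?mem_cat ?xL //; move: xL; rewrite -has_pred1 has_count; lia.
- have : (size (boundary Y ++ M) <= size (boundary X))%N.
    apply: uniq_leq_size => [|x].
      rewrite cat_uniq uniq_boundary uM andbT /=; apply/hasPn => x /ML xL.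
      rewrite mem_boundary; apply/negP => /and3P[yl yr _].
      by have [_ _] := w_out x yl yr; rewrite xL.
    rewrite mem_cat !mem_boundary => /orP[/and3P[yl yr ->]|/ML/LX[-> -> xR]].
      by have [-> ->] := w_out x yl yr.
    by rewrite mem_box; lia.
  by move=> le_bd; rewrite /cost addnAC -size_cat leq_add // missed_sub.
Qed.

(** The added triangle removes the side [e] from the boundary and contributes at most its two other
    sides, a net increase of at most 1; at least one blocked triangle is no longer missed. *)
Lemma fill_cost (X : pred cell) (D : seq cell) e :
  e \in box -> X (left e) -> ~~ X (right e) -> right e \in D ->
  (cost D (fun c => X c || (c == right e)) <= cost D X)%N.
Proof.
move=> eb xl xr cD; set c := right e in xr cD *.
set Y : pred cell := fun d => _ || _.
have -> : cost D X = (size (boundary X) + (missed Y D + count_mem c D))%N.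
  congr (_ + _)%N; rewrite /missed; elim: D {cD} => //= d D ->; rewrite /Y.
  case: eqP => [->|_]; first by rewrite xr orbT addnCA.
  by rewrite orbF addnA.
have cD1 : (0 < count_mem c D)%N by rewrite -has_count has_pred1.
set e' := rev_dart e.
suff : (size (e :: boundary Y) <= size [:: turn e', turn (turn e') & boundary X])%N.
  move=> h; rewrite /cost addnCA [leqLHS]addnC leq_add2l.
  by apply: leq_trans (leq_add (leqnn _) cD1); rewrite addn1.
apply: uniq_leq_size => [|y].
  by rewrite cons_uniq uniq_boundary mem_boundary /Y eqxx orbT /= andbF.
rewrite !inE !mem_boundary => /predU1P[->|/and3P[]]; first by rewrite xl xr eb !orbT.
rewrite /Y negb_or => yl /andP[yr _] yb; rewrite yr yb andbT /=.
case/orP: yl => [->|/eqP yc]; first by rewrite !orbT.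
have [ey|->|->] := left_eq (etrans yc (esym (left_rev e))); rewrite ?eqxx ?orbT //.
by move: yr; rewrite ey right_rev xl.
Qed.

(** * The invariant of the walk and its preservation *)

(* [inv_cost] remembers that [X] was optimal when only [E1] had been visited: since
   then Blocker has had at most [size E2] moves, and one fewer right after a move of
   Walker ([f] is [id] or [predn]). *)
Record inv (f : nat -> nat) (E : seq dart) (X : pred cell) (D : seq cell) : Prop := Inv {
  inv_walk : sorted linked E;
  inv_uniq : uniq E;
  inv_avoids : avoids E X;
  inv_left : forall x, x \in E -> X (left x);
  inv_joined : forall x, x \in E -> joined X (left x) (0, R%:Z, false);
  inv_near : forall x, x \in E -> `|x.1.1| < (size E)%:Z /\ `|x.1.2| < (size E)%:Z;
  inv_cost : forall E1 E2 Y, E = E1 ++ E2 -> avoids E1 Y -> exceeds X Y ->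
    (cost D X < cost D Y + f (size E2))%N }.

Lemma avoids_sub E1 E2 X : {subset E1 <= E2} -> avoids E2 X -> avoids E1 X.
Proof. by move=> E12 [EX low]; split=> // x /E12/EX. Qed.

Lemma exceeds_sub X Y Z : sub X Y -> exceeds Y Z -> exceeds X Z.
Proof.
move=> XY [YZ [x [xb Zx Yx]]]; split=> [c /XY/YZ //|].
by exists x; split=> //; apply: contra Yx; apply: XY.
Qed.

Lemma first_visit (A : eqType) (B : eqType) (g : A -> B) c E : c \in map g E ->
  exists E1 x E2, [/\ E = E1 ++ x :: E2, g x = c & c \notin map g E1].
Proof.
elim: E => //= x E IHE; rewrite inE eq_sym; have [<- _|nx /= /IHE] := eqVneq.
  by exists [::], x, E.
case=> E1 [y [E2 [-> yc yE]]]; exists (x :: E1), y, E2; split=> //=.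
by rewrite inE negb_or eq_sym nx.
Qed.

Section Step.
Variables (F : seq dart) (l : dart) (X : pred cell) (D : seq cell).
Hypothesis (I : inv id (rcons F l) X D) (szF : ((size F).+2 < R)%N).
Let e := next X l.

Let lE : l \in rcons F l. Proof. by rewrite mem_rcons inE eqxx. Qed.

Let le : X (left e) /\ ~~ X (right e).
Proof. by have [] := next_boundary (inv_left I lE) ((inv_avoids I).1 l lE). Qed.

Let je : joined X (left e) (0, R%:Z, false).
Proof.
have [_ _ j] := next_boundary (inv_left I lE) ((inv_avoids I).1 l lE).
exact: joined_trans j (inv_joined I lE).
Qed.

Let near_e : `|e.1.1| <= (size F).+1%:Z /\ `|e.1.2| <= (size F).+1%:Z.
Proof.
have [] := inv_near I lE; have -> : e.1 = target l by rewrite -(source_next X l).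
by rewrite size_rcons; case: (l) => [[a b] []] /=; lia.
Qed.

Let near x : x \in rcons (rcons F l) e ->
  [/\ X (left x), ~~ X (right x), joined X (left x) (0, R%:Z, false)
    & `|x.1.1| + 1 < R%:Z /\ `|x.1.2| + 1 < R%:Z].
Proof.
rewrite mem_rcons inE => /predU1P[->|xE].
  by have [? ?] := le; split=> //; move: near_e szF; case: (e) => [[a b] h] /=; lia.
split; [exact: (inv_left I) | exact: ((inv_avoids I).1) | exact: (inv_joined I)|].
by have := inv_near I xE; rewrite size_rcons; case: (x) => [[a b] h] /=; lia.
Qed.

(** Filling the pocket enclosed by [L] would save at least [size E2], against [inv_cost] for the
    prefix [E1]. *)
Let no_pocket E1 E2 L M : rcons F l = E1 ++ E2 ->
  cycle linked L -> L != [::] -> uniq M -> {subset M <= L} ->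
  {subset L <= rcons (rcons F l) e} -> (forall x, x \in E1 -> x \notin L) ->
  (size E2 <= size M)%N -> False.
Proof.
move=> FE cL L0 uM ML LE E1L sz.
have E1E x : x \in E1 -> x \in rcons (rcons F l) e.
  by rewrite FE mem_rcons inE mem_cat => ->; rewrite orbT.
have [|x /LE/near[]|||Y [YE XY]] // := @pocket X D E1 L M cL L0 uM ML.
- by have [_ ?] := inv_avoids I; split.
- by move=> x; rewrite mem_cat => /orP[/LE|/E1E] /near[].
- by move=> x xE; have [? ? _ _] := near (E1E x xE); rewrite E1L.
by have := inv_cost I FE YE XY; lia.
Qed.

(** Let [x] be the first dart with [right e] on its right. By [right_eq] the walk from [x] to [e]
    closes up at a vertex of this triangle and encloses a pocket, unless [x] is [l]: the sharp
    turn. *)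
Lemma revisit : right e \in map right (rcons F l) ->
  right e = right l /\ right e \notin map right F.
Proof.
case/first_visit=> E1 [x [E2 [FE xe eE1]]].
have xE2 : path linked x E2.
  by have := drop_sorted (size E1) (inv_walk I); rewrite FE drop_size_cat.
have lastE : last x E2 = l.
  by have := congr1 (last x) FE; rewrite last_rcons last_cat.
have el : source e = target l by apply: source_next.
have uE := inv_uniq I.
move: (uE); rewrite FE cat_uniq => /and3P[_ /hasPn/= disj uE2].
have sE2 : {subset x :: E2 <= rcons (rcons F l) e}.
  by move=> y yE; rewrite mem_rcons FE inE mem_cat yE !orbT.
have dis y : y \in E1 -> y \notin x :: E2.
  by move=> yE; apply/negP => /disj; rewrite /= yE.
have [ex|ex|ex] := right_eq (esym xe).
(* The loop runs from the source of [x] to the source of [e]. *)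
- case: (@no_pocket E1 (x :: E2) (x :: E2) (x :: E2)) => //.
  by rewrite /= rcons_path xE2 /linked lastE -el ex eqxx.
(* The loop starts after [x]; if nothing follows [x], then [x] is [l]. *)
- case: E2 => [|y E2] in FE lastE xE2 uE2 sE2 dis disj *.
    move: FE; rewrite cats1 => /rcons_inj[-> ->].
    by split; [exact: esym xe | exact: eE1].
  case: (@no_pocket (rcons E1 x) (y :: E2) (y :: E2) (y :: E2)) => //.
  + by rewrite cat_rcons.
  + move: xE2 => /= /andP[/eqP xy yE2].
    by rewrite rcons_path yE2 /linked (lastE : last y E2 = l) -el ex xy eqxx.
  + by case/andP: uE2.
  + by move=> z zE; apply: sE2; rewrite inE zE orbT.
  + move=> z; rewrite mem_rcons inE => /predU1P[->|/dis]; first by case/andP: uE2.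
    by rewrite inE => /norP[].
(* Here [e] itself closes the loop. It is left out of [M], whose elements must be distinct, and it
   is not in [E1] because [x] is the first visit. *)
- case: (@no_pocket E1 (x :: E2) (x :: rcons E2 e) (x :: E2)) => //.
  + by rewrite /= !rcons_path xE2 /linked last_rcons lastE el ex !eqxx.
  + by move=> y; rewrite !inE mem_rcons inE => /orP[->|->] //; rewrite !orbT.
  + move=> y; rewrite -rcons_cons mem_rcons inE => /predU1P[->|/sE2 //].
    by rewrite mem_rcons inE eqxx.
  + move=> y yE; rewrite -rcons_cons mem_rcons inE negb_or dis // andbT.
    by apply: contraNneq eE1 => <-; apply: map_f.
Qed.

(** By [fill_cost], adding a blocked [right e] would give a larger set at no extra cost, against
    [inv_cost] with [E2] empty. *)
Lemma unblocked : right e \notin map right (rcons F l) -> right e \notin D.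
Proof.
move=> eE; apply/negP => eD; have [xl xr] := le.
have eb : e \in box by rewrite mem_box; move: near_e szF; case: (e) => [[a b] h] /=; lia.
have := fill_cost eb xl xr eD; set Y : pred cell := fun c => _ => YX.
have [EX low] := inv_avoids I.
suff : (cost D X < cost D Y + 0)%N by rewrite addn0 ltnNge YX.
apply: (@inv_cost _ _ _ _ I (rcons F l) [::]); rewrite ?cats0 //.
  split=> [x xE|c cR]; rewrite /Y negb_or.
    by rewrite EX //=; apply: contraNneq eE => <-; apply: map_f.
  rewrite low //=; apply/eqP => ce; move: cR near_e; rewrite ce.
  by rewrite /right; case: (e) => [[a b] []] /=; lia.
split=> [c|]; first by rewrite /Y => ->.
by exists e; rewrite /Y eqxx orbT.
Qed.

(** The walk grows by one dart while Blocker does not move, so the old bounds hold with one less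
    than the new length of [E2]. *)
Lemma inv_next : e \notin rcons F l -> inv predn (rcons (rcons F l) e) X D.
Proof.
move=> eE; split.
- have := inv_walk I; case: (F) => [|x s] /=; rewrite ?rcons_path /linked;
  by rewrite ?last_rcons source_next ?eqxx // => ->.
- by rewrite rcons_uniq eE (inv_uniq I).
- by split=> [x /near[] //|]; apply: (inv_avoids I).2.
- by move=> x /near[].
- by move=> x /near[].
- move=> x; rewrite mem_rcons inE size_rcons => /predU1P[->|/(inv_near I)]; last first.
    by rewrite size_rcons; case: (x) => [[a b] h] /=; lia.
  by rewrite size_rcons; move: near_e; case: (e) => [[a b] h] /=; lia.
(* For empty [E2] truncated subtraction gives 0, and the old strict bound still applies. *)
move=> E1 E2 Y; case/lastP: E2 => [|E2 y].
  rewrite cats0 => <- YE XY.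
  have := @inv_cost _ _ _ _ I (rcons F l) [::] Y; rewrite cats0 => ->//.
  by apply: avoids_sub YE => x xE; rewrite mem_rcons inE xE orbT.
rewrite -rcons_cat => /rcons_inj[FE _] YE XY.
by rewrite size_rcons; apply: (inv_cost I FE YE XY).
Qed.

End Step.

Lemma inv_weaken E X D : inv predn E X D -> inv id E X D.
Proof.
case=> w u a le j n c; split=> // E1 E2 Y FE YE XY.
by apply: leq_trans (c _ _ _ FE YE XY) _; rewrite leq_add2l leq_pred.
Qed.

(** Blocker's move raises the cost of the old set by at most 1 and lowers no cost, which uses up the
    unit held back by [predn]. The case of empty [E2] is the new optimality. *)
Lemma reoptimise E X D b : inv predn E X D ->
  exists X', inv id E X' (b :: D).
Proof.
case=> walk uE aE lE jE nE cX.
have [Y [XY YE YX optY]] := optimum (b :: D) aE.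
exists Y; split=> // [x /lE/XY //|x /jE/(joined_sub XY) //|E1 E2 Z FE ZE YZ].
case: E2 FE => [|y E2] FE.
  by rewrite addn0; apply: optY => //; rewrite FE cats0.
have := cX _ _ _ FE ZE (exceeds_sub XY YZ).
have := cost_cons X b D; have := cost_cons_ge Z b D => /=; lia.
Qed.

(** Both triangles have the target of [x] as a vertex, so successive ones touch. *)
Lemma right_sectors X x : right x = sector (target x) (back x.2) /\
  right (next X x) = sector (target x) (cw (next X x).2).
Proof. by split; [apply: right_sector | rewrite -(source_next X x)]. Qed.

Definition touching (c c' : cell) : Prop :=
  c <> c' /\ exists v h h', c = sector v h /\ c' = sector v h'.

Lemma advance E X D : inv id E X D -> E != [::] -> ((size E).+2 < R)%N ->
  exists E', [/\ inv predn E' X D, (size E' <= (size E).+2)%N, E' != [::],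
    right (last dart0 E') \notin D &
    touching (right (last dart0 E)) (right (last dart0 E'))].
Proof.
case/lastP: E => // F l I _; rewrite last_rcons size_rcons => sz.
have szF : ((size F).+2 < R)%N by lia.
have nn x : next X x <> x.
  by move=> e; have := source_next X x; rewrite e; case: (x) => [[a b] []] [] //=; lia.
have fresh G x : inv id (rcons G x) X D -> ((size G).+2 < R)%N ->
    right (next X x) \notin map right (rcons G x) ->
  exists E', [/\ inv predn E' X D, size E' = (size G).+2, E' != [::],
    right (last dart0 E') \notin D &
    touching (right x) (right (last dart0 E'))].
  move=> J szG new; exists (rcons (rcons G x) (next X x)); split.
  - by apply: inv_next => //; apply: contra new; apply: map_f.
  - by rewrite !size_rcons.
  - by case: G {J szG new}.
  - by rewrite last_rcons; apply: unblocked new.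
  - rewrite last_rcons; split.
      by move=> e; move: new; rewrite -e map_f // mem_rcons inE eqxx.
    by have [-> ->] := right_sectors X x; eexists _, _, _.
have [old|new] := boolP (right (next X l) \in map right (rcons F l)).
  have [el eF] := revisit I szF old.
  have eE : next X l \notin rcons F l.
    rewrite mem_rcons inE negb_or (introN eqP (nn l)) /=.
    by apply: contra eF; apply: map_f.
  have J := inv_weaken (inv_next I szF eE).
  have sz2 : ((size (rcons F l)).+2 < R)%N by rewrite size_rcons; lia.
  have [old2|new2] := boolP (right (next X (next X l)) \in
      map right (rcons (rcons F l) (next X l))).
    (* Two sharp turns in a row are impossible: [revisit] would make the triangle new to the walk up
       to [l], contrary to [old]. *)
    have [e2 /negP[]] := revisit J sz2 old2.
    by rewrite e2.
  have [E' [? szE' ? ? ?]] := fresh _ _ J sz2 new2.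
  by exists E'; rewrite -el; split=> //; rewrite szE' size_rcons.
have [E' [? szE' ? ? ?]] := fresh _ _ I szF new.
by exists E'; split=> //; rewrite szE'.
Qed.

(** * The starting position: the upper half-plane *)

Definition upper : pred cell := fun c => 0 <= c.1.2.

Lemma upper_boundary x : x \in boundary upper -> x.1.2 = 0 /\ x.2 = East.
Proof.
rewrite mem_boundary /upper; case: x => [[a b] h] /and3P[] /=.
rewrite /left /right /=; case: h => //= u d _; by [split=> //; lia | exfalso; lia].
Qed.

(** Descend the column through alternately upward and downward triangles: it must leave [Z] before
    the floor. *)
Lemma column (Z : pred cell) a : sub upper Z -> avoids [::] Z -> `|a| <= R%:Z ->
  exists x, x \in boundary Z /\ x.1.1 = a.
Proof.
move=> uZ [_ lowZ] aR.
have col n : (n <= R)%N ->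
    Z (a, - n%:Z, false) \/ exists x, x \in boundary Z /\ x.1.1 = a.
  elim: n => [|n IHn] nR; first by left; apply: uZ.
  have [Zn|] := IHn (ltnW nR); last by right.
  have [Zd|Zd] := boolP (Z (a, - n%:Z - 1, true)); last first.
    right; exists (a, - n%:Z, East).
    by rewrite mem_boundary mem_box /left /right /= Zn Zd; lia.
  have en : - n.+1%:Z = - n%:Z - 1 :> int by lia.
  have [Zu|Zu] := boolP (Z (a, - n.+1%:Z, false)); first by left.
  right; exists (a, - n%:Z, SEast).
  rewrite mem_boundary mem_box /left /right /= Zd -en Zu; lia.
have [Zl|//] := col R (leqnn _).
by have := lowZ (a, - R%:Z, false) (lexx _); rewrite Zl.
Qed.

(* Each of the columns of the box meets the boundary of [Z]. *)
Lemma upper_min Z : sub upper Z -> avoids [::] Z -> (cost [::] upper <= cost [::] Z)%N.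
Proof.
move=> uZ aZ; rewrite /cost /missed /= !addn0.
rewrite -(size_map (fun x : dart => x.1.1) (boundary upper)).
rewrite -(size_map (fun x : dart => x.1.1) (boundary Z)).
apply: uniq_leq_size => [|_ /mapP[x xu ->]].
  rewrite map_inj_in_uniq ?uniq_boundary // => x y.
  case/upper_boundary=> x2 xh /upper_boundary[y2 yh] xy.
  by move: x y x2 xh y2 yh xy => [[? ?] ?] [[? ?] ?] /= -> -> -> -> ->.
have [|y [yb <-]] := column (a := x.1.1) uZ aZ; last exact: map_f.
by move: xu; rewrite mem_boundary mem_box => /and3P[_ _ /andP[]].
Qed.

(* The half-plane is not a strict minimiser of the boundary length; the first edge
   [x0], walked before Blocker has moved, makes up for it. *)
Lemma start : (3 < R)%N -> exists E X, inv predn E X [::] /\ size E = 2%N.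
Proof.
move=> R3; pose x0 := dart0.
have up0 : avoids [:: x0] upper.
  split=> [x|[[p q] t] /= cR]; last by rewrite /upper -ltNge /=; lia.
  by rewrite inE => /eqP ->.
have [X [uX aX Xu optX]] := optimum [::] up0.
have J : inv id (rcons [::] x0) X [::].
  split=> //=.
  - by move=> x; rewrite inE => /eqP ->; apply: uX.
  - move=> x; rewrite inE => /eqP -> w Xw.
    (* Climb column 0 from [left x0], two edges per row, inside the half-plane. *)
    have : forall n, w (left x0) = w (0, n%:Z, false).
      elim=> [//|n ->].
      have := Xw (0, n.+1%:Z, SEast); rewrite /left /right /=.
      have -> : n.+1%:Z - 1 = n%:Z :> int by lia.
      have := Xw (0, n.+1%:Z, East); rewrite /left /right /=.
      have -> : n.+1%:Z - 1 = n%:Z :> int by lia.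
      by move=> -> => [->||]; try exact: uX.
    by apply.
  - by move=> x; rewrite inE => /eqP ->.
  - move=> E1 E2 Y FE YE XY.
    case: E1 FE YE => [|y E1] /= FE YE.
      rewrite -FE /= addn1 ltnS; apply: leq_trans Xu _.
      by apply: upper_min YE => c /uX; apply: XY.1.
    case: FE YE => <-; case: E1 => //= <- YE.
    by rewrite addn0; apply: optX.
exists (rcons (rcons [::] x0) (next X x0)), X; split=> //.
apply: (inv_next J (ltnW R3)).
rewrite /= inE; apply/eqP => e; have := source_next X x0.
by rewrite e.
Qed.

End Cost.

(** * Projection of wedge moves to triangle moves *)

(** The first six entries lead from an upward triangle to the downward ones touching it; from a
    downward triangle the first, second, fourth, sixth, seventh and eighth do the converse. The last
    six are the translations. *)
Definition gens : seq (int * int * bool) :=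
  [:: (-1, 0, true); (0, -1, true); (-1, -1, true); (0, 0, true);
      (1, -1, true); (-1, 1, true); (0, 1, true); (-2, 1, true);
      (1, 0, false); (-1, 0, false); (0, 1, false); (0, -1, false);
      (1, -1, false); (-1, 1, false)].

Definition act (g : int * int * bool) (c : cell) : cell :=
  (c.1.1 + g.1.1 + (c.2 && g.2 : bool)%:Z, c.1.2 + g.1.2, c.2 (+) g.2).

Lemma touching_gens c c' : touching c c' -> exists2 g, g \in gens & c' = act g c.
Proof.
case=> cc' [[a b] [h [h' [ec ec']]]].
suff /hasP [g gG /eqP ->] : has (fun g => c' == act g c) gens by exists g.
rewrite {}ec {}ec' in cc' *.
by case: h h' cc' => [] [] //= _; rewrite /act /= !xpair_eqE /=; lia.
Qed.

Section Walker.
Variables d k : nat.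
Hypothesis hd : (14 <= d)%N.

Definition gen (i : 'I_d) : int * int * bool := nth (0, 0, false) gens i.

(* [act] adds 1 to the first coordinate on every move from a downward triangle to an
   upward one, whence the term [m./2]. *)
Definition proj (c0 : cell) (f : 'I_d -> nat) : cell :=
  let m := (c0.2 + \sum_i f i * (gen i).2)%N in
  (c0.1.1 + \sum_i (f i)%:Z * (gen i).1.1 + (m./2)%:Z,
   c0.1.2 + \sum_i (f i)%:Z * (gen i).1.2, odd m).

Lemma proj0 c0 f : f =1 (fun=> 0%N) -> proj c0 f = c0.
Proof.
move=> f0; have sumz (g : 'I_d -> int) : \sum_i (f i)%:Z * g i = 0.
  by rewrite big1 // => i _; rewrite f0 mul0r.
have sumn : (\sum_i f i * (gen i).2 = 0)%N by rewrite big1 // => i _; rewrite f0.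
rewrite /proj !sumz sumn addn0 oddb.
by case: c0 => [[a b] t]; case: t; rewrite /= !addr0.
Qed.

(** A flip raises [m./2] exactly when [m] is odd, that is, from a downward triangle: this is the
    offset in [act]. *)
Lemma proj_step c0 f f' j : (forall i, f' i = f i + (i == j))%N ->
  proj c0 f' = act (gen j) (proj c0 f).
Proof.
move=> ff'; rewrite /proj /act /=.
have sumz (g : 'I_d -> int) : \sum_i (f' i)%:Z * g i = \sum_i (f i)%:Z * g i + g j.
  under eq_bigr do rewrite ff' PoszD mulrDl.
  rewrite big_split /=; congr (_ + _).
  by rewrite (bigD1 j) //= eqxx mul1r big1 ?addr0 // => i /negPf ->; rewrite mul0r.
have sumn (g : 'I_d -> nat) : (\sum_i f' i * g i = \sum_i f i * g i + g j)%N.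
  under eq_bigr do rewrite ff' mulnDl.
  rewrite big_split /=; congr (_ + _)%N.
  by rewrite (bigD1 j) //= eqxx mul1n big1 ?addn0 // => i /negPf ->.
rewrite !sumz sumn addnA; set m := (c0.2 + _)%N; apply/eqP; rewrite !xpair_eqE oddD oddb.
rewrite halfD oddb.
by rewrite -andbA; apply/and3P; split=> //; case: (gen j).2; case: (odd m) => /=; lia.
Qed.

Lemma bottom_ex : (0 < k)%N -> exists x : wedge d k, coord x =1 (fun=> 0%N).
Proof. by move=> k0; apply: wedge_surj; rewrite big1. Qed.

Lemma step_ex (x : wedge d k) j : ((level x).+1 < k)%N ->
  exists y : wedge d k, [/\ forall i, (coord y i = coord x i + (i == j))%N,
    level y = (level x).+1 & (x < y)%O].
Proof.
move=> xk; have sumE : (\sum_i (coord x i + (i == j)) = (level x).+1)%N.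
  rewrite big_split /= -addn1; congr (_ + _)%N.
  by rewrite (bigD1 j) //= eqxx big1 // => i /negPf ->.
have [|y yE] := @wedge_surj d k (fun i => coord x i + (i == j))%N; first by rewrite sumE.
have yl : level y = (level x).+1 by rewrite -sumE; apply: eq_bigr => i _.
exists y; split=> //; rewrite lt_neqAle wedge_le; apply/andP; split.
  by apply/eqP => xy; move: yl; rewrite xy; lia.
by apply/forallP => i; rewrite yE leq_addr.
Qed.

Local Notation T := (wedge d k).

Lemma walker_moves_rcons (h : seq T) x : walker_moves (rcons h x) =
  if odd (size h) then walker_moves h else rcons (walker_moves h) x.
Proof.
rewrite /walker_moves size_rcons mkseqS mask_rcons ?size_mkseq //.
by case: (odd _) => /=; rewrite ?cats0 ?cats1.
Qed.

Lemma walker_moves2 (h : seq T) x y : ~~ odd (size h) ->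
  walker_moves (rcons (rcons h x) y) = rcons (walker_moves h) x.
Proof.
move=> eh; rewrite !walker_moves_rcons size_rcons /= eh.
by rewrite (negPf eh).
Qed.

(** * Walker's strategy in the wedge *)

Definition full (h : seq T) : Prop := exists c,
  [/\ sorted <%O c, subseq c (walker_moves h) & map (@level d k) c = iota 0 k].

Lemma full_sub h h' : subseq (walker_moves h) (walker_moves h') -> full h -> full h'.
Proof. by move=> hh' [c [? /subseq_trans/(_ hh') ? ?]]; exists c. Qed.

(** The walk gains at most two darts per move of Walker, so [2 * k] bounds its length; the margin 4
    also covers [start] when [k] is 0. *)
Let R := (k.*2 + 4)%N.

Variable c0 : cell.

Definition state (h : seq T) : Prop := exists E X D z,
  [/\ inv R id E X D, E != [::], (size E <= (size (walker_moves h)).*2)%N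
    & [/\ sorted <%O (walker_moves h),
          map (@level d k) (walker_moves h) = iota 0 (size (walker_moves h)),
          last z (walker_moves h) = z,
          proj c0 (coord z) = right (last dart0 E)
        & forall b, b \in h -> b \in walker_moves h \/ proj c0 (coord b) \in D]].

Definition start_ok : Prop := exists E X,
  [/\ inv R predn E X [::], size E = 2%N & c0 = right (last dart0 E)].

Definition play_ok (h : seq T) : Prop := [\/ full h, h = [::] | state h].

(** [advance] yields a touching triangle outside [D], and [touching_gens] a coordinate that leads
    there. The new element is not Blocker's, since its triangle is unblocked, nor Walker's, since
    its level is new. *)
Lemma play_continues h : start_ok -> ~~ odd (size h) -> play_ok h -> ~ full h ->
  exists x, x \notin h /\ forall y, play_ok (rcons (rcons h x) y).
Proof.
move=> [E0 [X0 [I0 sE0 cE0]]] eh.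
case=> [//|h0|[E [X [D [z [I E_ne szE [srt lev lastz projz blk]]]]]]] nf.
  rewrite {h}h0 in eh nf *.
  have k0 : (0 < k)%N.
    by rewrite lt0n; apply/eqP => k0; apply: nf; exists [::]; rewrite k0.
  have [x xE] := bottom_ex k0; exists x; split=> // y; constructor 3.
  have [X1 I1] := reoptimise (proj c0 (coord y)) I0.
  exists E0, X1, [:: proj c0 (coord y)], x; rewrite (@walker_moves2 [::]) //=.
  split=> //; [by rewrite -size_eq0 sE0 | by rewrite sE0 | split=> //].
  - by rewrite /level big1.
  - by rewrite proj0.
  - by move=> b; rewrite !inE => /orP[->|/eqP->]; [left | right].
set c := walker_moves h in szE srt lev lastz blk.
have c_gt0 : (0 < size c)%N.
  rewrite lt0n; apply: contraNneq E_ne => sc.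
  by rewrite -size_eq0 -leqn0; rewrite sc in szE.
have lz : level z = (size c).-1.
  have := congr1 (fun s => nth 0%N s (size c).-1) lev.
  by rewrite (nth_map z) ?nth_last ?lastz ?nth_iota ?prednK.
have ck : (size c < k)%N.
  rewrite ltnNge; apply/negP => kc; apply: nf; exists c; split=> //.
  rewrite lev; congr iota; apply/eqP; rewrite eqn_leq kc andbT.
  by have := level_lt z; rewrite lz; lia.
have [|E' [I' szE' E'_ne newE' tch]] := advance I E_ne; first by rewrite /R; lia.
have [g gG gE] := touching_gens tch.
have gd : (index g gens < d)%N.
  by apply: leq_trans hd; rewrite -[14%N]/(size gens) index_mem.
have [|x [xE xl zx]] := step_ex (x := z) (Ordinal gd); first by rewrite lz; lia.
have px : proj c0 (coord x) = right (last dart0 E').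
  by rewrite (proj_step c0 xE) /gen nth_index // projz.
exists x; split.
  apply/negP => /blk[xc|]; last by rewrite px (negPf newE').
  have : level x \in map (@level d k) c by rewrite map_f.
  by rewrite lev mem_iota xl lz; lia.
move=> y; constructor 3.
have [X2 I2] := reoptimise (proj c0 (coord y)) I'.
exists E', X2, (proj c0 (coord y) :: D), x; rewrite walker_moves2 // -/c.
split=> //; first by rewrite size_rcons; lia.
split; rewrite ?last_rcons //.
- by case: (c) c_gt0 srt lastz => //= a s _ srt lastz; rewrite rcons_path srt lastz.
- by rewrite map_rcons lev xl lz prednK // size_rcons -[(size c).+1]addn1 iotaD cats1.
- move=> b; rewrite mem_rcons inE => /predU1P[->|]; first by right; rewrite inE eqxx.
  rewrite mem_rcons inE => /predU1P[->|/blk[bc|bD]].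
  + by left; rewrite mem_rcons inE eqxx.
  + by left; rewrite mem_rcons inE bc orbT.
  + by right; rewrite inE bD orbT.
Qed.

Definition good_move (h : seq T) (x : T) : Prop :=
  x \notin h /\ forall y, play_ok (rcons (rcons h x) y).

Definition strategy (h : seq T) : option T :=
  match excluded_middle_informative (exists x, good_move h x) with
  | Specif.left ex => Some (proj1_sig (constructive_indefinite_description _ ex))
  | Specif.right _ => [pick x | x \notin h]
  end.

Lemma strategy_legal : walker_strategy strategy.
Proof.
move=> h uh _ sh; rewrite /strategy.
case: excluded_middle_informative => [ex|_].
  by case: constructive_indefinite_description => x [xh _] /=; exists x.
case: pickP => [x xh|all_h]; first by exists x.
move: sh; rewrite ltnNge cardE uniq_leq_size ?enum_uniq // => x _.
by have /negbFE := all_h x.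
Qed.

Lemma strategy_good h x : (exists y, good_move h y) -> strategy h = Some x ->
  good_move h x.
Proof.
move=> ex; rewrite /strategy; case: excluded_middle_informative => // ex'.
by case=> <-; apply: proj2_sig.
Qed.

Hypothesis st : start_ok.

Lemma play_ok_prefix p : follows strategy p -> forall n h t,
  p = h ++ t -> size h = n.*2 -> play_ok h.
Proof.
move=> fp; elim=> [|n IHn] h t pE; first by move/size0nil => ->; constructor 2.
case/lastP: h pE => // h y; case/lastP: h => [|h x]; first by [].
rewrite !size_rcons !cat_rcons => pE [sh].
have ok := IHn h _ pE sh; have eh : ~~ odd (size h) by rewrite sh odd_double.
have [fh|nfh] := classic (full h).
  constructor 1; apply: full_sub fh; rewrite walker_moves2 //; apply: subseq_rcons.
exact: (strategy_good (play_continues st eh ok nfh) (fp _ _ _ pE eh)).2.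
Qed.

Lemma play_full p : complete_play p -> follows strategy p -> full p.
Proof.
move=> [up allp] fp; have [//|nf] := classic (full p).
have := odd_double_half (size p); case: (boolP (odd (size p))) => op pn; last first.
  have ok := play_ok_prefix fp (esym (cats0 p)) (esym pn).
  by have [x [xp _]] := play_continues st op ok nf; rewrite allp in xp.
case/lastP: p up allp fp nf op pn => // h x up allp fp nf op pn.
have eh : ~~ odd (size h) by move: op; rewrite size_rcons.
have hE : rcons h x = h ++ [:: x] by rewrite cats1.
have sh : size h = (size h)./2.*2.
  by have := odd_double_half (size h); rewrite (negPf eh).
have ok := play_ok_prefix fp hE sh.
have wx y : walker_moves (rcons (rcons h x) y) = walker_moves (rcons h x).
  by rewrite walker_moves_rcons op.
have nfh : ~ full h.
  move=> fh; apply: nf; apply: full_sub fh.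
  by rewrite walker_moves_rcons (negPf eh); apply: subseq_rcons.
(* Walker made the last move of the play. Since [good_move] allows any reply, even a repetition, [x]
   serves as a fictitious move of Blocker, after which a further unchosen element would exist. *)
have [_ /(_ x) ok'] := strategy_good (play_continues st eh ok nfh) (fp _ _ _ hE eh).
have nf' : ~ full (rcons (rcons h x) x).
  by move=> f'; apply: nf; apply: full_sub f'; rewrite wx.
have [|z [zh _]] := play_continues st _ ok' nf'; first by rewrite !size_rcons /= negbK.
by move: zh; rewrite mem_rcons inE allp orbT.
Qed.

End Walker.

Local Close Scope ring_scope.

Theorem theorem2 (d k : nat) (hd : 14 <= d) :
  walker_can_force (fun p : seq (wedge d k) =>
    exists c : seq (wedge d k),
      [/\ walker_builds p c, size c = k
        & forall l : nat, l < k -> exists2 x, x \in c & level x = l]).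
Proof.
have [|E [X [I E2]]] := @start (k.*2 + 4)%N; first by rewrite addnC.
pose c0 := right (last dart0 E).
have st : start_ok k c0 by exists E, X.
exists (@strategy d k c0); first exact: strategy_legal.
move=> p cp fp; have [c [srt sub_c lev]] := play_full hd st cp fp.
exists c; split=> //; first by have := congr1 size lev; rewrite size_map size_iota.
move=> l lk; have /mapP [x xc xl] : l \in map (@level d k) c by rewrite lev mem_iota.
by exists x.
Qed.
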